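(* Let $m$ be a positive integer, let $\mathcal I=\{I_1,\dots,I_d\}$ be a partition of $\{1,\dots,m\}$ into non-empty disjoint sets (listed in this order), and let $\mathbf p=(p_1,\dots,p_m)\in(1,2m]^m$ be such that $\sum_{j=1}^m\frac1{p_j}<1$. Let $$s_k=\left[\frac12-\sum_{j\in\bigcup_{i=k}^dI_i}\frac1{p_j}+\frac1{2m}\sum_{i=k}^d|I_i|\right]^{-1},\qquad k=1,\dots,d,$$ and $\mathbf s=(s_1,\dots,s_d)$. Then there exists a constant $D^{\mathbb K}_{m,\mathbf p,\mathbf s}\ge1$ such that $$\left(\sum_{i_1=1}^{N}\left(\cdots\left(\sum_{i_d=1}^{N}\left|A\left(\sum_{n=1}^d\sum_{j\in I_n}e_{i_n}\cdot e_j\right)\right|^{s_d}\right)^{\frac{s_{d-1}}{s_d}}\cdots\right)^{\frac{s_1}{s_2}}\right)^{\frac1{s_1}}\le D^{\mathbb K}_{m,\mathbf p,\mathbf s}\,\|A\|$$ for all positive integers $N$ and all $m$-linear forms $A:\ell_{p_1}^N\times\cdots\times\ell_{p_m}^N\to\mathbb K$.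
   Context: $\mathbb K$ is $\mathbb R$ or $\mathbb C$; $\ell_p^N$ is $\mathbb K^N$ with the $\ell_p$-norm; $|I|$ is the cardinality of a finite set $I$; $\|A\|$ is the usual sup norm of $A$ over the product of the closed unit balls. The expression $\sum_{n=1}^d\sum_{j\in I_n}e_{i_n}\cdot e_j$ denotes the $m$-tuple whose $j$-th coordinate is the canonical unit vector $e_{i_n}$, where $n$ is the index with $j\in I_n$ (for example, if $m=5$, $I_1=\{1,3\}$, $I_2=\{2,4\}$, $I_3=\{5\}$, it is $(e_{i_1},e_{i_2},e_{i_1},e_{i_2},e_{i_3})$). *)

(* Defs.v *)
From HB Require Import structures.
From mathcomp Require Import all_boot all_order all_algebra.
From mathcomp Require Import complex.
From mathcomp Require Import all_classical all_reals all_analysis.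

Set Implicit Arguments.
Unset Strict Implicit.
Unset Printing Implicit Defensive.
Import Order.TTheory GRing.Theory Num.Theory.
Local Open Scope classical_set_scope.
Local Open Scope ring_scope.

Variant scalar_field := RealScalars | ComplexScalars.

Definition scalars (R : realType) (KK : scalar_field) : numFieldType :=
  match KK with
  | RealScalars => R
  | ComplexScalars => R[i]
  end.

(* MathComp's norm on R[i] is R[i]-valued; its real part is the usual modulus. *)
Definition modulus (R : realType) (KK : scalar_field) : scalars R KK -> R :=
  match KK with
  | RealScalars => fun x : R => `|x|
  | ComplexScalars => fun z : R[i] => complex.Re `|z|
  end.

Section Forms.
Variables (R : realType) (KK : scalar_field) (m N : nat).
Local Notation K := (scalars R KK).

Definition lp_norm (q : R) (x : 'rV[K]_N) : R :=
  (\sum_(i < N) modulus (x ord0 i) `^ q) `^ q^-1.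

Definition multilinear_form (A : ('I_m -> 'rV[K]_N) -> K) : Prop :=
  forall (j : 'I_m) (x : 'I_m -> 'rV[K]_N),
    scalar (fun v : 'rV[K]_N => A [eta x with j |-> v]).

Definition form_norm (p : 'I_m -> R) (A : ('I_m -> 'rV[K]_N) -> K) : R :=
  sup [set modulus (A x) | x in
        [set x : 'I_m -> 'rV[K]_N | forall j, lp_norm (p j) (x j) <= 1]].

(* j-th coordinate of \sum_n \sum_(j in I_n) e_{i_n} . e_j, where v . e_j is
   the m-tuple with v in position j and 0 elsewhere; when the I_n are a
   partition, a single n contributes. *)
Definition block_basis (d : nat) (I : 'I_d -> {set 'I_m})
    (i : d.-tuple 'I_N) : 'I_m -> 'rV[K]_N :=
  fun j => \sum_(n < d | j \in I n) delta_mx ord0 (tnth i n).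

End Forms.

Arguments block_basis {R KK m N d} I i.

(* nested_sum [s_1; ..; s_d] f =
     \sum_(i_1) (\sum_(i_2) ( .. (\sum_(i_d) f(i_1, .., i_d) `^ s_d) ..
       ) `^ (s_2 / s_3)) `^ (s_1 / s_2),
   where the default value 1 of head makes the innermost exponent s_d / 1. *)
Fixpoint nested_sum (R : realType) (N d : nat) :
    d.-tuple R -> (d.-tuple 'I_N -> R) -> R :=
  match d with
  | 0 => fun _ f => f [tuple]
  | d'.+1 => fun s f =>
      let s' : d'.-tuple R := [tuple of behead s] in
      \sum_(i < N)
        nested_sum s' (fun u : d'.-tuple 'I_N => f [tuple of i :: u])
          `^ (thead s / head 1 s')
  end.

Definition mixed_sum (R : realType) (N d : nat) (s : d.-tuple R)
    (f : d.-tuple 'I_N -> R) : R :=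
  nested_sum s f `^ (head 1 s)^-1.

Definition block_exponent (R : realType) (m d : nat) (I : 'I_d -> {set 'I_m})
    (p : 'I_m -> R) (k : 'I_d) : R :=
  (2^-1 - \sum_(j in (\bigcup_(i < d | (k <= i)%N) I i)%SET) (p j)^-1
   + (2 * m%:R)^-1 * (\sum_(i < d | (k <= i)%N) #|I i|)%:R)^-1.

(* Main.v *)
Require Import Defs.
From mathcomp Require Import all_boot all_order all_algebra.
From mathcomp Require Import complex.
From mathcomp Require Import all_classical all_reals all_analysis.
From mathcomp Require Import ring lra.

Set Implicit Arguments.
Unset Strict Implicit.
Unset Printing Implicit Defensive.
Import Order.TTheory GRing.Theory Num.Theory.
Local Open Scope ring_scope.

(** Keeping only the terms of A whose index is constant on each block (averaging
over signs) and passing to real and imaginary parts, everything reduces to real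
arrays a indexed by d-tuples for which the sum of
  a_u * prod_n +-v_n(u_n)^(th_n) w_n(u_n)^(ga_n)
is at most M for all subprobability vectors v_n, w_n, where
th_n = |I_n| / (2m) sums to 1/2 and ga_n is the sum over I_n of 1/p_j - 1/(2m).
The v-part is removed first: by Khinchine's inequality the array
b = a^2 prod w^(2 ga) satisfies mixed (l_1, l_2) bounds in every coordinate,
which are turned into the l_1 bound on b by trading the weights v_n, one
coordinate at a time, against a larger outer exponent.  What remains says that
the nonnegative array a^2 is a bounded form on a product of l_q spaces, and
duality in one coordinate at a time, together with the superadditivity of
nested sums, gives the mixed norm bound. *)

(** * Power inequalities *)

(** The powers of such weights with exponent [q^-1] are exactly the nonnegative vectors in the unit
    ball of l_q, so one set of weights serves all the spaces. *)
Definition subprob (R : realType) (N : nat) (v : 'I_N -> R) : Prop :=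
  (forall i, 0 <= v i) /\ \sum_(i < N) v i <= 1.

Section Powers.
Variable R : realType.
Implicit Types (x y e : R).

Lemma powR_young x y e : 0 <= x -> 0 <= y -> 0 <= e <= 1 ->
  x `^ e * y `^ (1 - e) <= e * x + (1 - e) * y.
Proof.
move=> x0 y0 /andP[e0 e1].
have [->|en0] := eqVneq e 0.
  by rewrite powRr0 subr0 powRr1 // mul0r !mul1r add0r.
have [->|en1] := eqVneq e 1.
  by rewrite subrr powRr0 powRr1 // mul0r mulr1 mul1r addr0.
have egt0 : 0 < e by rewrite lt0r en0.
have elt1 : 0 < 1 - e by rewrite subr_gt0 lt_neqAle en1.
have := @conjugate_powR R (x `^ e) (y `^ (1 - e)) e^-1 (1 - e)^-1.
rewrite !invrK -!powRrM !divff ?gt_eqF // !powRr1 // => /(_ _ _ _ _ _).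
rewrite [x * _]mulrC [y * _]mulrC; apply; rewrite ?powR_ge0 ?invr_gt0 ?invrK //.
by rewrite ?invr_gt0 ?invrK addrC subrK.
Qed.

Lemma powR_le1 x e : 0 <= x <= 1 -> 0 <= e -> x `^ e <= 1.
Proof.
move=> /andP[x0 x1] e0; have <- : 1 `^ e = 1 by rewrite powR1.
by apply: ge0_ler_powR; rewrite ?nnegrE.
Qed.

(** One factor [F t] is split off each power; the remaining power, of exponent [e - 1], is at most
    that of the total. *)
Lemma powR_sum_superadd (T : finType) (P : pred T) (F : T -> R) e :
  (forall t, 0 <= F t) -> 1 <= e ->
  \sum_(t | P t) F t `^ e <= (\sum_(t | P t) F t) `^ e.
Proof.
move=> F0 e1; have S0 : 0 <= \sum_(t | P t) F t by apply: sumr_ge0.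
have e0 : 0 < e := lt_le_trans ltr01 e1.
rewrite -(mulr_powRB1 S0 e0) mulr_suml; apply: ler_sum => t Pt.
rewrite -(mulr_powRB1 (F0 t) e0) ler_wpM2l //.
apply: ge0_ler_powR; rewrite ?nnegrE ?subr_ge0 //.
by rewrite (bigD1 t) //= lerDl sumr_ge0.
Qed.

(** Divide by the two totals and apply [powR_young] termwise; the conjugate exponents are [e^-1] and
    [(1 - e)^-1]. *)
Lemma hoelder_sum (T : finType) (P : pred T) (F G : T -> R) e :
  (forall t, 0 <= F t) -> (forall t, 0 <= G t) -> 0 <= e <= 1 ->
  \sum_(t | P t) F t `^ e * G t `^ (1 - e)
    <= (\sum_(t | P t) F t) `^ e * (\sum_(t | P t) G t) `^ (1 - e).
Proof.
move=> F0 G0 e01; move: (e01) => /andP[e0 e1].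
have [->|en0] := eqVneq e 0.
  rewrite powRr0 subr0 powRr1 ?sumr_ge0 // mul1r; apply: ler_sum => t _.
  by rewrite powRr0 powRr1 // mul1r.
have [->|en1] := eqVneq e 1.
  rewrite subrr powRr0 powRr1 ?sumr_ge0 // mulr1; apply: ler_sum => t _.
  by rewrite powRr0 powRr1 // mulr1.
have en1' : 1 - e != 0 by rewrite subr_eq0 eq_sym.
set X := \sum_(t | P t) F t; set Y := \sum_(t | P t) G t.
have X0 : 0 <= X by apply: sumr_ge0.
have Y0 : 0 <= Y by apply: sumr_ge0.
have [XE|Xn0] := eqVneq X 0.
  rewrite big1 ?mulr_ge0 ?powR_ge0 // => t Pt.
  by rewrite (psumr_eq0P _ XE) // powR0 // mul0r.
have [YE|Yn0] := eqVneq Y 0.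
  rewrite big1 ?mulr_ge0 ?powR_ge0 // => t Pt.
  by rewrite (psumr_eq0P _ YE) // powR0 // mulr0.
have Xp : 0 < X by rewrite lt0r Xn0.
have Yp : 0 < Y by rewrite lt0r Yn0.
apply: (@le_trans _ _ (\sum_(t | P t)
    X `^ e * Y `^ (1 - e) * (e * (F t / X) + (1 - e) * (G t / Y)))).
  apply: ler_sum => t Pt.
  have XF : F t = X * (F t / X) by rewrite mulrCA divff // mulr1.
  have YG : G t = Y * (G t / Y) by rewrite mulrCA divff // mulr1.
  have xp : 0 <= F t / X by rewrite divr_ge0.
  have yp : 0 <= G t / Y by rewrite divr_ge0.
  rewrite {1}XF {1}YG (powRM _ X0 xp) (powRM _ Y0 yp) mulrACA ler_wpM2l ?mulr_ge0 ?powR_ge0 //.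
  exact: powR_young.
rewrite -mulr_sumr big_split /= -!mulr_sumr -!mulr_suml !divff //.
by rewrite !mulr1 addrC subrK mulr1.
Qed.

(* Extremal weights: [w] proportional to [F `^ (1 - e)^-1]. *)
Lemma subprob_dual (N : nat) (F : 'I_N -> R) (L e : R) :
  (forall i, 0 <= F i) -> 0 <= e < 1 ->
  (forall w, subprob w -> \sum_(i < N) w i `^ e * F i <= L) ->
  \sum_(i < N) F i `^ (1 - e)^-1 <= L `^ (1 - e)^-1.
Proof.
move=> F0 /andP[e0 e1] HL; set r := (1 - e)^-1.
have e1p : 0 < 1 - e by rewrite subr_gt0.
have rp : 0 < r by rewrite invr_gt0.
set Z := \sum_(i < N) _.
have Z0 : 0 <= Z by apply: sumr_ge0 => i _; exact: powR_ge0.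
have [->|Zn0] := eqVneq Z 0; first exact: powR_ge0.
have Zp : 0 < Z by rewrite lt0r Zn0.
have /HL ZL : subprob (fun i => F i `^ r / Z).
  split=> [i|]; first by rewrite divr_ge0 ?powR_ge0.
  by rewrite -mulr_suml divff.
have rE : r = r * e + 1.
  by rewrite -[LHS](mulr1 r) -[in LHS](subrK e 1) addrC mulrDr mulVf ?gt_eqF.
have ZV : Z^-1 `^ e = (Z `^ e)^-1.
  by rewrite -powR_inv1 // -powRrM mulN1r powRN.
have ZL' : Z `^ (1 - e) <= L.
  apply: le_trans ZL; rewrite powRB ?Zn0 ?implybT // powRr1 // {1}/Z mulr_suml.
  apply: ler_sum => i _.
  rewrite powRM ?powR_ge0 ?invr_ge0 // -powRrM ZV.
  rewrite mulrAC ler_wpM2r ?invr_ge0 ?powR_ge0 // [in leLHS]rE.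
  have [->|Fn0] := eqVneq (F i) 0.
    by rewrite powR0 ?mulr0 // -rE gt_eqF.
  by rewrite powRD ?Fn0 ?implybT // powRr1.
have -> : Z = (Z `^ (1 - e)) `^ r by rewrite -powRrM divff ?gt_eqF // powRr1.
apply: ge0_ler_powR => //; rewrite ?nnegrE ?powR_ge0 ?(ltW rp) //.
exact: le_trans (powR_ge0 _ _) ZL'.
Qed.

End Powers.

(** * Transfer of mixed-norm bounds *)

Section ExponentTransfer.
Variables (R : realType) (G : finType) (N : nat).
Implicit Types (b : G -> R) (pi rho : G -> 'I_N).

Lemma fiber_sum_swap b pi (F : 'I_N -> R) :
  \sum_(i < N) (\sum_(g | pi g == i) b g) * F i = \sum_g b g * F (pi g).
Proof.
rewrite [RHS](partition_big pi predT) //=; apply: eq_bigr => i _.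
by rewrite mulr_suml; apply: eq_bigr => g /eqP ->.
Qed.

Section Step.
Variables (b : G -> R) (pi rho : G -> 'I_N) (B t e e' : R).
Hypothesis b0 : forall g, 0 <= b g.
Hypothesis B0 : 0 <= B.
Hypotheses (t0 : 0 < t) (e0 : 0 < e) (e'0 : 0 < e') (e'1 : e' <= 1).
Hypothesis ee' : e'^-1 = e^-1 - t.

(** The weight is constant on each fiber of [pi], so it leaves the inner sum with exponent [t * e];
    [subprob_dual] then turns [e] into [e / (1 - t * e) = e']. *)
Lemma fiber_bound_raise_self :
  (forall v, subprob v ->
     \sum_(i < N) (\sum_(g | pi g == i) b g * v (pi g) `^ t) `^ e <= B `^ e) ->
  \sum_(i < N) (\sum_(g | pi g == i) b g) `^ e' <= B `^ e'.
Proof.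
move=> H.
have te : 0 < 1 - t * e.
  by rewrite -(pmulr_lgt0 _ (_ : 0 < e^-1)) ?invr_gt0 // mulrBl mul1r mulfK
    ?gt_eqF // -ee' invr_gt0.
have e'E : e' = e * (1 - t * e)^-1.
  apply: invr_inj; rewrite ee' invfM invrK mulrBr mulr1 mulrCA mulVf ?gt_eqF //.
  by rewrite mulr1.
rewrite e'E powRrM (eq_bigr _ (fun i _ => powRrM _ _ _)).
apply: subprob_dual; [by move=> i; exact: powR_ge0| |move=> v sv].
  by rewrite mulr_ge0 ?ltW //= -subr_gt0.
apply: le_trans (H v sv); apply: ler_sum => i _.
rewrite powRrM -powRM ?powR_ge0 ?sumr_ge0 //.
apply: ge0_ler_powR; rewrite ?nnegrE ?(ltW e0) //.
- by rewrite mulr_ge0 ?powR_ge0 ?sumr_ge0.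
- by apply: sumr_ge0 => g _; rewrite mulr_ge0 ?powR_ge0.
by rewrite mulr_sumr; apply: ler_sum => g /eqP ->; rewrite mulrC.
Qed.

(* Test the hypothesis on the weights proportional to the [e']-th powers of the
   sums of [b] along the fibers of [pi]; Hölder's inequality then moves the
   bound on the fibers of [pi] to those of [rho]. *)
Lemma fiber_bound_raise :
  (forall v, subprob v ->
     \sum_(i < N) (\sum_(g | pi g == i) b g * v (pi g) `^ t) `^ e <= B `^ e) ->
  (forall v, subprob v ->
     \sum_(i < N) (\sum_(g | rho g == i) b g * v (pi g) `^ t) `^ e <= B `^ e) ->
  \sum_(i < N) (\sum_(g | rho g == i) b g) `^ e' <= B `^ e'.
Proof.
move=> /fiber_bound_raise_self; set r := fun i => \sum_(g | pi g == i) b g.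
set Z := \sum_(i < N) _ => ZB H.
have r0 i : 0 <= r i by apply: sumr_ge0.
have Z0 : 0 <= Z by apply: sumr_ge0 => i _; exact: powR_ge0.
have br g : b g <= r (pi g).
  by rewrite /r (bigD1 g) //= lerDl; apply: sumr_ge0.
have [ZE|Zn0] := eqVneq Z 0.
  have bE g : b g = 0.
    apply/le_anti; rewrite b0 andbT; apply: le_trans (br g) _.
    have /powR_eq0_eq0 -> // : r (pi g) `^ e' = 0.
    by apply: (psumr_eq0P _ ZE) => // i _; exact: powR_ge0.
  rewrite big1 ?powR_ge0 // => i _.
  by rewrite big1 // powR0 // gt_eqF.
have Zp : 0 < Z by rewrite lt0r Zn0.
pose v i := r i `^ e' / Z.
have v0 i : 0 <= v i by rewrite divr_ge0 ?powR_ge0.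
have sv : subprob v by split=> //; rewrite -mulr_suml divff.
have {}H := H v sv.
have e1p : 0 < e^-1 - 1.
  by move: ee' e'1 t0; rewrite -invf_ge1 // => ->; lra.
(* [e'^-1] is the convex combination of [e^-1] and 1 with weights [h] and [1 - h]. *)
pose h := (e'^-1 - 1) / (e^-1 - 1).
have hE : h * (e^-1 - 1) = e'^-1 - 1 by rewrite /h divfK ?gt_eqF.
have h1 : 1 - h = t / (e^-1 - 1).
  rewrite /h -[X in X - _](@divff _ (e^-1 - 1)) ?gt_eqF // -mulrBl ee'.
  by congr (_ / _); ring.
have h01 : 0 <= h <= 1.
  rewrite -[X in _ && X]subr_ge0 h1 !divr_ge0 ?(ltW t0) ?(ltW e1p) //.
  by rewrite subr_ge0 invf_ge1.
have h1n0 : 1 - h != 0 by rewrite h1 mulf_neq0 ?invr_eq0 ?gt_eqF.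
(* Chosen so that the powers of [v] cancel when Hölder's inequality with [h] and [1 - h] is applied
   to the sums [T] and [V] below. *)
pose s := e'^-1 - 1.
have sE : t * h = s * (1 - h).
  by rewrite h1 /s -hE -mulrA [_ * (t / _)]mulrC divfK ?gt_eqF // mulrC.
clearbody h.
pose T i := \sum_(g | rho g == i) b g * v (pi g) `^ t.
pose V i := \sum_(g | rho g == i) b g * v (pi g) `^ (- s).
have T0 i : 0 <= T i by apply: sumr_ge0 => g _; rewrite mulr_ge0 ?powR_ge0.
have V0 i : 0 <= V i by apply: sumr_ge0 => g _; rewrite mulr_ge0 ?powR_ge0.
have S_le i : \sum_(g | rho g == i) b g <= T i `^ h * V i `^ (1 - h).
  apply: (le_trans _ (hoelder_sum _ _ _ h01)); last 2 first.
  - by move=> g; rewrite mulr_ge0 ?powR_ge0.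
  - by move=> g; rewrite mulr_ge0 ?powR_ge0.
  apply: ler_sum => g _.
  have [bgE|bgn0] := eqVneq (b g) 0; first by rewrite bgE mulr_ge0 ?powR_ge0.
  have vp : 0 < v (pi g).
    rewrite divr_gt0 // powR_gt0 // (lt_le_trans _ (br g)) // lt0r bgn0.
    exact: b0.
  rewrite !(powRM _ (b0 g) (powR_ge0 _ _)) -!powRrM mulrACA mulNr -sE.
  have -> : v (pi g) `^ (t * h) * v (pi g) `^ (- (t * h)) = 1.
    rewrite -powRD; last by rewrite (gt_eqF vp) implybT.
    by rewrite subrr powRr0.
  rewrite mulr1 -powRD ?bgn0 ?implybT //.
  by rewrite addrC subrK powRr1.
(* The total of [V] does not depend on [rho]: regrouped along [pi] it is at most [Z] to the power
   [1 + s = e'^-1], hence at most [B]. *)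
have VB : \sum_(i < N) V i <= B.
  have -> : \sum_(i < N) V i = \sum_(i < N) r i * v i `^ (- s).
    rewrite fiber_sum_swap [RHS](partition_big rho predT) //=.
  have -> : B = (B `^ e') `^ e'^-1.
    by rewrite -powRrM divff ?gt_eqF // powRr1.
  apply: (@le_trans _ _ (Z `^ e'^-1)); last first.
    by apply: ge0_ler_powR; rewrite ?nnegrE ?invr_ge0 ?powR_ge0 ?(ltW e'0).
  have -> : e'^-1 = 1 + s by rewrite /s addrC subrK.
  rewrite powRD ?Zn0 ?implybT // powRr1 // {1}/Z mulr_suml.
  apply: ler_sum => i _.
  have [->|rn0] := eqVneq (r i) 0; first by rewrite mul0r mulr_ge0 ?powR_ge0.
  have rp : 0 < r i by rewrite lt0r rn0 r0.
  rewrite /v powRM ?powR_ge0 ?invr_ge0 // mulrA.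
  have -> : Z^-1 `^ (- s) = Z `^ s.
    by rewrite -powR_inv1 // -powRrM mulN1r opprK.
  rewrite ler_wpM2r ?powR_ge0 // -powRrM.
  rewrite -{1}[r i]powRr1 // -powRD ?rn0 ?implybT //.
  have -> // : 1 + e' * - s = e'.
  by rewrite /s mulrN mulrBr mulfV ?gt_eqF //; ring.
(* Conjugacy for a second Hölder inequality, now over [i], which combines the bounds on [T] and
   [V]. *)
have hee : e' * h / e = 1 - e' * (1 - h).
  have : e' * (h * (e^-1 - 1)) = e' * (e'^-1 - 1) by rewrite hE.
  by rewrite [in X in _ = X -> _]mulrBr mulfV ?gt_eqF //; lra.
pose q := 1 - e' * (1 - h).
have q01 : 0 <= q <= 1.
  rewrite /q.
  move: h01 => /andP[hge0 hle1]; apply/andP; split.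
    by rewrite -hee divr_ge0 ?(ltW e0) // mulr_ge0 ?(ltW e'0).
  by rewrite gerBl mulr_ge0 ?(ltW e'0) // subr_ge0.
have qE : 1 - q = e' * (1 - h) by rewrite /q; ring.
apply: (@le_trans _ _ (\sum_(i < N) (T i `^ e) `^ q * V i `^ (1 - q))).
  apply: ler_sum => i _.
  rewrite qE -powRrM /q -hee mulrCA divff ?gt_eqF // mulr1.
  rewrite [e' * h]mulrC [e' * (1 - h)]mulrC !powRrM -powRM ?powR_ge0 //.
  apply: ge0_ler_powR; rewrite ?nnegrE ?mulr_ge0 ?powR_ge0 ?(ltW e'0) //.
  exact: sumr_ge0.
have Te0 i : 0 <= T i `^ e by exact: powR_ge0.
apply: (le_trans (@hoelder_sum _ _ predT _ _ q Te0 V0 q01)).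
have -> : B `^ e' = (B `^ e) `^ q * B `^ (1 - q).
  rewrite qE -powRrM /q -hee mulrCA divff ?gt_eqF // mulr1 -powRD.
    by congr (_ `^ _); ring.
  by rewrite -mulrDr addrC subrK mulr1 gt_eqF.
rewrite ler_pM ?powR_ge0 //; apply: ge0_ler_powR;
  rewrite ?nnegrE ?powR_ge0 ?sumr_ge0 //.
  by have /andP[] := q01.
by rewrite qE mulr_ge0 ?(ltW e'0) // subr_ge0; case/andP: h01.
Qed.

End Step.
End ExponentTransfer.

(** Induction on the number [k] of removed weights. Each step is [fiber_bound_raise] with [pi] the
    coordinate of the removed weight and [rho] any coordinate; the exponent climbs from 1/2 with all
    weights to 1 with none, where the fiber sums add up to the full sum. *)
Lemma sum_le_of_fiber_bounds (R : realType) (G : finType) (N d : nat)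
    (b : G -> R) (pi : 'I_d -> G -> 'I_N) (t : 'I_d -> R) (B : R) :
  (0 < d)%N -> (forall g, 0 <= b g) -> 0 <= B ->
  (forall n, 0 < t n) -> \sum_n t n = 1 ->
  (forall (v : 'I_d -> 'I_N -> R) (j : 'I_d), (forall n, subprob (v n)) ->
     \sum_(i < N) (\sum_(g | pi j g == i)
        b g * \prod_n v n (pi n g) `^ t n) `^ 2^-1 <= B `^ 2^-1) ->
  \sum_g b g <= B.
Proof.
move=> d0 b0 B0 t0 t1 H.
pose e k := (2 - \sum_(n < d | (n < k)%N) t n)^-1.
have sum_lt k : \sum_(n < d | (n < k)%N) t n <= 1.
  rewrite -t1 [leRHS](bigID (fun n : 'I_d => (n < k)%N)) /= lerDl.
  by apply: sumr_ge0 => n _; exact: ltW.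
have eV k : 1 <= (e k)^-1 by rewrite invrK; have := sum_lt k; lra.
have ep k : 0 < e k by rewrite -invr_gt0 (lt_le_trans ltr01).
have P (k : nat) : (k <= d)%N -> forall (v : 'I_d -> 'I_N -> R) (j : 'I_d),
  (forall n, subprob (v n)) -> \sum_(i < N) (\sum_(g | pi j g == i)
    b g * \prod_(n < d | (k <= n)%N) v n (pi n g) `^ t n) `^ e k <= B `^ e k.
- elim: k => [_ v j sv|k IH kd v j sv].
    have -> : e 0 = 2^-1 by rewrite /e big_pred0 ?subr0.
    exact: H.
  pose k0 := Ordinal kd.
  have ek : (e k.+1)^-1 = (e k)^-1 - t k0.
    rewrite !invrK (bigD1 k0) //= opprD addrCA addrC; congr (_ - _ - _).
    apply: eq_bigl => n; rewrite ltnS (leq_eqVlt n) -(inj_eq val_inj) /=.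
    by case: eqP => [->|_]; rewrite ?ltnn ?andbT //= ?orbF ?andbF.
  (* The test weight of the removal step becomes the [k0]-th weight of the family, to which the
     induction hypothesis applies. *)
  have prodE (w : 'I_N -> R) g :
      b g * \prod_(n < d | (k < n)%N) v n (pi n g) `^ t n * w (pi k0 g) `^ t k0
    = b g * \prod_(n < d | (k <= n)%N)
        (if n == k0 then w else v n) (pi n g) `^ t n.
    rewrite [in RHS](bigD1 k0) //= eqxx -mulrA; congr (_ * _); rewrite mulrC.
    congr (_ * _); apply: congr_big => // n.
      rewrite (leq_eqVlt k) -(inj_eq val_inj) /= eq_sym.
      by case: eqP => [->|_]; rewrite ?ltnn ?andbT //= ?orbF ?andbF.
    by move=> kn; rewrite -(inj_eq val_inj) /= gtn_eqF.
  have sw (w : 'I_N -> R) : subprob w ->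
      forall n, subprob (if n == k0 then w else v n).
    by move=> sw n; case: ifP.
  apply: (fiber_bound_raise _ B0 (t0 k0) (ep k) (ep k.+1) _ ek (pi := pi k0)).
  + by move=> g; rewrite mulr_ge0 ?prodr_ge0 // => n _; exact: powR_ge0.
  + by rewrite -invf_ge1 ?eV.
  + move=> w hw; under eq_bigr => i _ do under eq_bigr => g _ do rewrite prodE.
    by apply: (IH (ltnW kd) (fun n => if n == k0 then w else v n)); exact: sw.
  + move=> w hw; under eq_bigr => i _ do under eq_bigr => g _ do rewrite prodE.
    by apply: (IH (ltnW kd) (fun n => if n == k0 then w else v n)); exact: sw.
have v0 (n : 'I_d) : subprob (fun _ : 'I_N => 0 : R).
  by split=> //; rewrite big1 ?ler01.
have := P d (leqnn d) _ (Ordinal d0) v0.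
have -> : e d = 1.
  rewrite /e (eq_bigl predT) ?t1; last by move=> n; rewrite ltn_ord.
  by rewrite (_ : 2 - 1 = 1) ?invr1 //; ring.
rewrite powRr1 // [X in _ -> X <= _](partition_big (pi (Ordinal d0)) predT) //=.
apply: le_trans; apply: ler_sum => i _.
rewrite powRr1; last first.
  by apply: sumr_ge0 => g _; rewrite mulr_ge0 ?prodr_ge0 // => n _; exact: powR_ge0.
apply: ler_sum => g _; rewrite big_pred0 ?mulr1 // => n.
by rewrite leqNgt ltn_ord.
Qed.

(** * Nested sums *)

Lemma sum_tuple_cons (V : nmodType) (T : finType) (d : nat)
    (F : d.+1.-tuple T -> V) :
  \sum_u F u = \sum_(i : T) \sum_(u : d.-tuple T) F [tuple of i :: u].
Proof.
rewrite pair_bigA (reindex (fun p : T * d.-tuple T => [tuple of p.1 :: p.2])) //.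
exists (fun u => (thead u, [tuple of behead u])) => [[i u] _|u _] /=.
  by congr (_, _); apply: val_inj.
by rewrite -tuple_eta.
Qed.

Section NestedSums.
Variable R : realType.

(** The default 1 of [nth] acts as an exponent after the last one, so the innermost sum obeys the
    same recursion as the others. *)
Lemma nested_sum_cons (N d : nat) (s : d.+1.-tuple R) (f : d.+1.-tuple 'I_N -> R) :
  nested_sum s f = \sum_(i < N)
    nested_sum [tuple of behead s] (fun u => f [tuple of i :: u])
      `^ (nth 1 s 0 / nth 1 s 1).
Proof.
case/tupleP: s => x s; case: d s f => [|d] s f; first by rewrite [s]tuple0.
by case/tupleP: s f.
Qed.

Lemma nested_sum_ge0 (N d : nat) (s : d.-tuple R) (f : d.-tuple 'I_N -> R) :
  (forall u, 0 <= f u) -> 0 <= nested_sum s f.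
Proof.
case: d s f => [|d] s f f0; first exact: f0.
by rewrite nested_sum_cons; apply: sumr_ge0 => i _; exact: powR_ge0.
Qed.

(** The quotients of consecutive exponents telescope, so only the outermost exponent remains. *)
Lemma nested_sum_scale (N d : nat) (s : d.-tuple R) (c : R) (f : d.-tuple 'I_N -> R) :
  (forall k, (k <= d)%N -> 0 < nth 1 s k) -> 0 <= c -> (forall u, 0 <= f u) ->
  nested_sum s (fun u => c * f u) = c `^ nth 1 s 0 * nested_sum s f.
Proof.
elim: d s f => [|d IH] s f s0 c0 f0.
  by rewrite tuple0 /= powRr1.
rewrite !nested_sum_cons mulr_sumr; apply: eq_bigr => i _.
rewrite IH // => [|k kd]; last by rewrite nth_behead s0.
rewrite powRM ?powR_ge0 ?nested_sum_ge0 // -powRrM nth_behead.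
by rewrite mulrCA divff ?mulr1 // gt_eqF // s0.
Qed.

(** Exponents that decrease inwards, down to the default 1, have all quotients at least 1, so
    [powR_sum_superadd] works at every level. *)
Lemma nested_sum_superadd (N d : nat) (J : finType) (s : d.-tuple R)
    (f : J -> d.-tuple 'I_N -> R) :
  (forall k, (k <= d)%N -> 0 < nth 1 s k) ->
  (forall k, (k < d)%N -> nth 1 s k.+1 <= nth 1 s k) ->
  (forall j u, 0 <= f j u) ->
  \sum_j nested_sum s (f j) <= nested_sum s (fun u => \sum_j f j u).
Proof.
elim: d s f => [//|d IH] s f s0 sm f0.
have sb : 1 <= nth 1 s 0 / nth 1 s 1 by rewrite ler_pdivlMr ?mul1r ?s0 ?sm.
under eq_bigr do rewrite nested_sum_cons.
rewrite exchange_big nested_sum_cons; apply: ler_sum => i _ /=.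
apply: (@le_trans _ _ ((\sum_j nested_sum [tuple of behead s]
    (fun u => f j [tuple of i :: u])) `^ (nth 1 s 0 / nth 1 s 1))).
  by apply: powR_sum_superadd => // j; exact: nested_sum_ge0.
apply: ge0_ler_powR; rewrite ?nnegrE.
- exact: le_trans sb.
- by apply: sumr_ge0 => j _; exact: nested_sum_ge0.
- by apply: nested_sum_ge0 => u; exact: sumr_ge0.
by apply: IH => // k kd; rewrite !nth_behead ?s0 ?sm.
Qed.

(** Duality in the first coordinate reduces to testing against one weight [v]. Homogeneity moves [v]
    inside the inner nested sums, superadditivity merges these into the nested sum of one array with
    one coordinate fewer, and induction applies to it. *)
Lemma nested_sum_dual (N d : nat) (t : d.-tuple R) (e : nat -> R)
    (b : d.-tuple 'I_N -> R) (L : R) :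
  (forall n, 0 <= e n) ->
  (forall k, (k <= d)%N -> 0 < nth 1 t k) ->
  (forall k, (k <= d)%N -> (nth 1 t k)^-1 = 1 - \sum_(k <= n < d) e n) ->
  (forall u, 0 <= b u) ->
  (forall w : nat -> 'I_N -> R, (forall n, subprob (w n)) ->
     \sum_u b u * \prod_(n < d) w n (tnth u n) `^ e n <= L) ->
  nested_sum t b <= L `^ nth 1 t 0.
Proof.
elim: d t e b => [|d IH] t e b e0 t0 tE b0 H.
  rewrite tuple0 /=; have /H : forall n : nat, subprob (fun _ : 'I_N => 0 : R).
    by split=> //; rewrite big1 ?ler01.
  rewrite (bigD1 [tuple]) //= big_ord0 mulr1 big_pred0 ?addr0; last first.
    by move=> u; apply/negbF/eqP; exact: tuple0.
  move=> bL; rewrite powRr1 //; exact: le_trans bL.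
have t1E : (nth 1 t 0)^-1 = (nth 1 t 1)^-1 - e 0%N.
  by rewrite !tE // big_nat_recl // [in RHS]big_add1 opprD addrA addrAC.
have t1p := t0 1%N isT; have t0p := t0 0%N isT.
(* The exponent for which [subprob_dual] produces exactly the outer quotient
   [nth 1 t 0 / nth 1 t 1]. *)
have eE : 1 - e 0%N * nth 1 t 1 = nth 1 t 1 / nth 1 t 0.
  by rewrite t1E mulrBr mulfV ?gt_eqF // mulrC.
(* The reciprocals are 1 minus tail sums of the nonnegative [e], so they grow with [k]. *)
have tm k : (k < d)%N -> nth 1 (behead t) k.+1 <= nth 1 (behead t) k.
  move=> kd; rewrite !nth_behead -lef_pV2 ?posrE ?t0 ?ltnS // 1?ltnW //.
  rewrite !tE ?ltnS // 1?ltnW // [in leLHS]big_ltn ?ltnS //.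
  by rewrite lerB // lerDr.
rewrite nested_sum_cons.
have -> : nth 1 t 0 / nth 1 t 1 = (1 - e 0%N * nth 1 t 1)^-1 by rewrite eE invf_div.
have -> : L `^ nth 1 t 0 = (L `^ nth 1 t 1) `^ (1 - e 0%N * nth 1 t 1)^-1.
  by rewrite -powRrM eE invf_div mulrC divfK ?gt_eqF.
apply: subprob_dual => [i||v sv]; first exact: nested_sum_ge0.
  by rewrite mulr_ge0 ?(ltW t1p) //= -subr_gt0 eE divr_gt0.
have tb k : (k <= d)%N -> 0 < nth 1 (behead t) k by move=> ?; rewrite nth_behead t0.
apply: (@le_trans _ _ (nested_sum [tuple of behead t]
    (fun u => \sum_(i < N) v i `^ e 0%N * b [tuple of i :: u]))).
  apply: le_trans (nested_sum_superadd _ _ _) => //; last first.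
    by move=> j u; rewrite mulr_ge0 ?powR_ge0.
  apply: ler_sum => i _; rewrite nested_sum_scale ?powR_ge0 //.
  by rewrite -powRrM nth_behead.
have := IH [tuple of behead t] (fun n => e n.+1)
   (fun u => \sum_(i < N) v i `^ e 0%N * b [tuple of i :: u]).
rewrite nth_behead; apply => //.
- by move=> k kd; rewrite nth_behead tE ?ltnS // big_add1.
- by move=> u; apply: sumr_ge0 => i _; rewrite mulr_ge0 ?powR_ge0.
move=> w sw; have := H (fun n => if n is k.+1 then w k else v).
rewrite sum_tuple_cons exchange_big /= => Hw.
apply: le_trans (Hw _); last by case.
apply: ler_sum => u _; rewrite mulr_suml; apply: ler_sum => i _.
rewrite big_ord_recl /= tnth0 mulrA [b _ * _]mulrC ler_wpM2l ?mulr_ge0 ?powR_ge0 //.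
by rewrite le_eqVlt; apply/orP; left; apply/eqP/eq_bigr => n _; rewrite tnthS.
Qed.

(** Only the innermost quotient changes, its denominator being the default 1; the factor 2 gained
    there becomes the square. *)
Lemma nested_sum_double (N d : nat) (t : d.-tuple R) (f : d.-tuple 'I_N -> R) :
  (0 < d)%N -> (forall u, 0 <= f u) ->
  nested_sum [tuple of map ( *%R 2) t] f = nested_sum t (fun u => f u ^+ 2).
Proof.
case: d t f => // d t f _.
elim: d t f => [|d IH] t f f0.
  case/tupleP: t => x t; rewrite [t]tuple0 /=; apply: eq_bigr => i _.
  by rewrite -powR_mulrn // -powRrM !divr1.
rewrite !nested_sum_cons; apply: eq_bigr => i _.
have -> : [tuple of behead [tuple of map ( *%R 2) t]]
        = [tuple of map ( *%R 2) [tuple of behead t]].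
  by apply: val_inj; case/tupleP: t.
have := IH [tuple of behead t] (fun u => f [tuple of i :: u]) (fun u => f0 _).
move=> ->; congr (_ `^ _).
by rewrite !(nth_map 1) ?size_tuple // -mulf_div divff ?mul1r.
Qed.

End NestedSums.

(** * Khinchine's inequality *)

Section Khinchine.
Variable R : realType.

Definition rademacher (b : bool) : R := (-1) ^+ b.
Local Notation sg := rademacher.

(** Splitting off the first sign cancels its odd powers and leaves a recursion for both moments. *)
Lemma rademacher_moments (N : nat) (c : 'I_N -> R) :
  let X (e : N.-tuple bool) := \sum_i c i * sg (tnth e i) in
  let V := \sum_i c i ^+ 2 in
  \sum_e X e ^+ 2 = 2 ^+ N * V /\ \sum_e X e ^+ 4 <= 3 * 2 ^+ N * V ^+ 2.
Proof.
elim: N c => [|N IH] c /=.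
  rewrite !big_ord0 !expr0n /= !mulr0; split; rewrite ?big1 // => e _;
    by rewrite big_ord0 expr0n.
set X := fun e : N.-tuple bool => \sum_i c (lift ord0 i) * sg (tnth e i).
set V := \sum_(i < N) c (lift ord0 i) ^+ 2.
have [H2 H4] : \sum_e X e ^+ 2 = 2 ^+ N * V /\
    \sum_e X e ^+ 4 <= 3 * 2 ^+ N * V ^+ 2 by exact: IH.
have XE (b : bool) (e : N.-tuple bool) : \sum_i c i * sg (tnth [tuple of b :: e] i) = c ord0 * sg b + X e.
  by rewrite big_ord_recl tnth0; congr (_ + _); apply: eq_bigr => i _; rewrite tnthS.
have V0 : 0 <= V by apply: sumr_ge0 => i _; exact: sqr_ge0.
rewrite !big_ord_recl -/V !sum_tuple_cons.
rewrite (eq_bigr _ (fun b _ => eq_bigr _ (fun e _ => congr1 (fun x => x ^+ 2) (XE b e)))).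
rewrite [X in _ /\ X <= _](eq_bigr _ (fun b _ => eq_bigr _ (fun e _ => congr1 (fun x => x ^+ 4) (XE b e)))).
rewrite !big_bool /rademacher /= -!big_split /= expr0 expr1.
have n2 : \sum_(e : N.-tuple bool) (1 : R) = 2 ^+ N.
  by rewrite sumr_const card_tuple card_bool -natrX.
have p2 : 0 <= 2 ^+ N :> R by rewrite exprn_ge0.
split.
  rewrite (eq_bigr (fun e => 2 * c ord0 ^+ 2 * 1 + 2 * X e ^+ 2)); last first.
    by move=> e _; ring.
  by rewrite big_split /= -!mulr_sumr n2 H2 [2 ^+ N.+1]exprS; ring.
rewrite (eq_bigr (fun e => 2 * c ord0 ^+ 4 * 1 +
  (12 * c ord0 ^+ 2 * X e ^+ 2 + 2 * X e ^+ 4))); last by move=> e _; ring.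
rewrite !big_split /= -!mulr_sumr n2 H2 [2 ^+ N.+1]exprS.
(* The two sides differ by at least four times this quantity. *)
have : 0 <= 2 ^+ N * c ord0 ^+ 4 by rewrite mulr_ge0 // exprn_even_ge0.
by set P := 2 ^+ N in H4 *; nra.
Qed.

(* The fourth moment controls the first from below because
   [t * (t - l) ^+ 2 * (t + 2 * l) >= 0] for [t, l >= 0]. *)
Lemma khinchine_l1 (N : nat) (c : 'I_N -> R) :
  2 ^+ N * Num.sqrt (\sum_i c i ^+ 2)
    <= Num.sqrt 3 * \sum_(e : N.-tuple bool) `|\sum_i c i * sg (tnth e i)|.
Proof.
have [] := rademacher_moments c.
set X := fun e : N.-tuple bool => \sum_i c i * sg (tnth e i).
set V := \sum_i c i ^+ 2 => H2 H4.
have V0 : 0 <= V by apply: sumr_ge0 => i _; exact: sqr_ge0.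
have [->|Vn0] := eqVneq V 0.
  by rewrite sqrtr0 mulr0 mulr_ge0 ?sqrtr_ge0 ?sumr_ge0.
have Vp : 0 < V by rewrite lt0r Vn0.
set v := Num.sqrt V; set K := Num.sqrt 3.
have vp : 0 < v by rewrite sqrtr_gt0.
have Kp : 0 < K by rewrite sqrtr_gt0.
have vE : V = v ^+ 2 by rewrite sqr_sqrtr.
have KE : K ^+ 2 = 3 by rewrite sqr_sqrtr.
(* With [l ^+ 2 = 3 * V], the fourth moment absorbs only a third of the left side of [H] below. *)
set l := K * v; have lp : 0 < l by rewrite mulr_gt0.
have lE : l ^+ 2 = 3 * V by rewrite exprMn KE -vE.
set A := \sum_e _.
have H : 3 * l ^+ 2 * (2 ^+ N * V) <= 2 * l ^+ 3 * A + 3 * 2 ^+ N * V ^+ 2.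
  apply: le_trans (lerD (lexx _) H4).
  rewrite -H2 !mulr_sumr -big_split; apply: ler_sum => e _ /=.
  set t := `|_|; have t0 : 0 <= t by exact: normr_ge0.
  rewrite -(real_normK (num_real (X e))) -/t.
  have -> : X e ^+ 4 = t ^+ 4.
    by rewrite /t -(normrX 4) ger0_norm // exprn_even_ge0.
  have : 0 <= t * (t - l) ^+ 2 * (t + 2 * l).
    apply: mulr_ge0; first exact: mulr_ge0 t0 (sqr_ge0 _).
    by apply: addr_ge0 => //; lra.
  by lra.
have : 2 * l ^+ 2 * (2 ^+ N * V) <= 2 * l ^+ 2 * (l * A).
  rewrite lE in H *; have lE3 : l ^+ 3 = 3 * V * l by rewrite exprSr lE.
  by rewrite lE3 in H; lra.
rewrite ler_pM2l ?mulr_gt0 ?exprn_gt0 // vE /l => HA.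
by rewrite -(ler_pM2l vp); lra.
Qed.

Lemma cauchy_schwarz_sum (T : finType) (F G : T -> R) :
  (forall t, 0 <= F t) -> (forall t, 0 <= G t) ->
  \sum_t F t * G t <= Num.sqrt (\sum_t F t ^+ 2) * Num.sqrt (\sum_t G t ^+ 2).
Proof.
move=> F0 G0.
have h01 : 0 <= (2^-1 : R) <= 1 by rewrite invr_ge0 ler0n invf_le1 ?ler1n.
have := hoelder_sum predT (fun t => sqr_ge0 (F t)) (fun t => sqr_ge0 (G t)) h01.
have -> : 1 - 2^-1 = 2^-1 :> R by lra.
rewrite !powR12_sqrt ?sumr_ge0 // => [|t _|t _]; rewrite ?sqr_ge0 //.
apply: le_trans; apply: ler_sum => t _.
by rewrite !powR12_sqrt ?sqr_ge0 // !sqrtr_sqr !ger0_norm.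
Qed.

(** [A ^+ 2] is a double sum pairing [m] with the absolute values of [F]; Cauchy-Schwarz in [s] for
    each [t] yields a factor [A], which cancels. *)
Lemma minkowski_sum (S T : finType) (F : S -> T -> R) :
  Num.sqrt (\sum_s (\sum_t `|F s t|) ^+ 2) <= \sum_t Num.sqrt (\sum_s F s t ^+ 2).
Proof.
set A := Num.sqrt _; pose m s := \sum_t `|F s t|.
have m0 s : 0 <= m s by apply: sumr_ge0.
have [->|An0] := eqVneq A 0; first by rewrite sumr_ge0.
have Ap : 0 < A by rewrite lt0r An0 sqrtr_ge0.
rewrite -(ler_pM2l Ap) -expr2 sqr_sqrtr; last by apply: sumr_ge0 => s _; exact: sqr_ge0.
have -> : \sum_s (\sum_t `|F s t|) ^+ 2 = \sum_t \sum_s m s * `|F s t|.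
  by rewrite exchange_big; apply: eq_bigr => s _; rewrite -mulr_sumr expr2.
rewrite mulr_sumr; apply: ler_sum => t _.
apply: le_trans (cauchy_schwarz_sum m0 (fun s => normr_ge0 _)) _.
rewrite ler_wpM2l ?sqrtr_ge0 //.
by rewrite (eq_bigr _ (fun s _ => real_normK (num_real (F s t)))).
Qed.

(** Induction on [d]: [khinchine_l1] in the first coordinate for fixed signs in the others,
    [minkowski_sum] to bring the sum over those signs under the root, then the induction hypothesis
    on each slice. *)
Lemma khinchine_chaos (N d : nat) (c : d.-tuple 'I_N -> R) :
  (2 ^+ N) ^+ d * Num.sqrt (\sum_u c u ^+ 2)
  <= Num.sqrt 3 ^+ d * \sum_(e : d.-tuple (N.-tuple bool))
       `|\sum_u c u * \prod_(n < d) sg (tnth (tnth e n) (tnth u n))|.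
Proof.
elim: d c => [|d IH] c.
  rewrite !expr0 !mul1r (bigD1 [tuple]) //= big_pred0 ?addr0; last first.
    by move=> u; apply/negbF/eqP; exact: tuple0.
  rewrite (bigD1 [tuple]) //= [X in _ + X]big_pred0 ?addr0; last first.
    by move=> u; apply/negbF/eqP; exact: tuple0.
  rewrite (bigD1 [tuple]) //= [X in _ + X]big_pred0 ?addr0; last first.
    by move=> u; apply/negbF/eqP; exact: tuple0.
  by rewrite big_ord0 mulr1 sqrtr_sqr.
pose X (i : 'I_N) (e : d.-tuple (N.-tuple bool)) := \sum_(u : d.-tuple 'I_N) c [tuple of i :: u] *
  \prod_(n < d) sg (tnth (tnth e n) (tnth u n)).
have XE (e1 : N.-tuple bool) (e : d.-tuple (N.-tuple bool)) : \sum_u c u * \prod_(n < d.+1)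
      sg (tnth (tnth [tuple of e1 :: e] n) (tnth u n))
    = \sum_i X i e * sg (tnth e1 i).
  rewrite sum_tuple_cons; apply: eq_bigr => i _.
  rewrite /X mulr_suml; apply: eq_bigr => u _.
  rewrite big_ord_recl !tnth0 -mulrA; congr (_ * _); rewrite mulrC.
  by congr (_ * _); apply: eq_bigr => n _; rewrite !tnthS.
set W := \sum_(e : d.+1.-tuple (N.-tuple bool)) _.
have {W}-> : W = \sum_(e : d.-tuple (N.-tuple bool)) \sum_(e1 : N.-tuple bool)
    `|\sum_i X i e * sg (tnth e1 i)|.
  rewrite /W sum_tuple_cons exchange_big. apply: eq_bigr => e _.
  by apply: eq_bigr => e1 _; rewrite XE.
set p := 2 ^+ N; set K := Num.sqrt 3.
have p0 : 0 <= p by rewrite exprn_ge0.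
have K0 : 0 <= K by exact: sqrtr_ge0.
apply: (@le_trans _ _ (K ^+ d * \sum_e p * Num.sqrt (\sum_i X i e ^+ 2))); last first.
  rewrite exprSr -mulrA ler_wpM2l ?exprn_ge0 // mulr_sumr.
  by apply: ler_sum => e _; exact: khinchine_l1.
rewrite -mulr_sumr mulrCA exprS -mulrA ler_wpM2l //.
apply: (@le_trans _ _ (K ^+ d * Num.sqrt (\sum_i (\sum_e `|X i e|) ^+ 2))); last first.
  by rewrite ler_wpM2l ?exprn_ge0 //; exact: minkowski_sum.
rewrite -[p ^+ d]ger0_norm ?exprn_ge0 // -[K ^+ d]ger0_norm ?exprn_ge0 //.
rewrite -!sqrtr_sqr -!sqrtrM ?sqr_ge0 // ler_sqrt; last first.
  by rewrite mulr_ge0 ?sqr_ge0 // sumr_ge0 // => i _; exact: sqr_ge0.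
rewrite sum_tuple_cons !mulr_sumr; apply: ler_sum => i _.
have S0 : 0 <= \sum_(u : d.-tuple 'I_N) c [tuple of i :: u] ^+ 2.
  by apply: sumr_ge0 => u _; exact: sqr_ge0.
rewrite -[X in _ * X](sqr_sqrtr S0) -!exprMn.
by rewrite ler_sqr ?nnegrE ?mulr_ge0 ?exprn_ge0 ?sqrtr_ge0 ?sumr_ge0.
Qed.

(** [khinchine_chaos] bounds each slice by a sum over signs of absolute values. These are opened by
    a sign depending on [i], which is absorbed into the signs of coordinate [j], so the slices add
    up to one admissible sum. *)
Lemma fiber_khinchine (N d : nat) (a : d.-tuple 'I_N -> R) (M : R) (j : 'I_d) :
  (forall e : 'I_d -> 'I_N -> R, (forall n i, `|e n i| = 1) ->
     \sum_u a u * \prod_(n < d) e n (tnth u n) <= M) ->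
  \sum_(i < N) Num.sqrt (\sum_(u | tnth u j == i) a u ^+ 2)
    <= Num.sqrt 3 ^+ d * M.
Proof.
move=> H.
have pp : 0 < (2 ^+ N) ^+ d :> R by rewrite !exprn_gt0.
rewrite -(ler_pM2l pp) mulr_sumr.
pose Y i (e : d.-tuple (N.-tuple bool)) := \sum_(u | tnth u j == i) a u *
  \prod_(n < d) sg (tnth (tnth e n) (tnth u n)).
apply: (@le_trans _ _ (\sum_(i < N) Num.sqrt 3 ^+ d * \sum_e `|Y i e|)).
  apply: ler_sum => i _.
  pose c u := if tnth u j == i then a u else 0.
  have <- : \sum_u c u ^+ 2 = \sum_(u | tnth u j == i) a u ^+ 2.
    rewrite [RHS]big_mkcond; apply: eq_bigr => u _.
    by rewrite /c; case: ifP => // _; rewrite expr0n.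
  apply: le_trans (khinchine_chaos c) _.
  rewrite ler_wpM2l ?exprn_ge0 ?sqrtr_ge0 //; apply: ler_sum => e _.
  rewrite le_eqVlt; apply/orP; left; apply/eqP; congr `|_|.
  rewrite /Y [RHS]big_mkcond; apply: eq_bigr => u _.
  by rewrite /c; case: ifP => // _; rewrite mul0r.
rewrite -mulr_sumr mulrCA ler_wpM2l ?exprn_ge0 ?sqrtr_ge0 // exchange_big /=.
have -> : (2 ^+ N) ^+ d * M = \sum_(e : d.-tuple (N.-tuple bool)) M.
  by rewrite sumr_const !card_tuple card_bool -[RHS]mulr_natl !natrX.
apply: ler_sum => e _.
pose s i : R := if Y i e < 0 then -1 else 1.
have s1 i : `|s i| = 1 by rewrite /s; case: ifP; rewrite ?normrN normr1.
have sgn1 b : `|sg b| = 1 by rewrite /rademacher normrX normrN normr1 expr1n.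
pose r n i := (if n == j then s i else 1) * sg (tnth (tnth e n) i).
have r1 n i : `|r n i| = 1.
  by rewrite normrM sgn1 mulr1; case: ifP; rewrite ?normr1.
apply: le_trans (H r r1).
rewrite le_eqVlt; apply/orP; left; apply/eqP.
rewrite [RHS](partition_big (fun u => tnth u j) predT) //=; apply: eq_bigr => i _.
have -> : `|Y i e| = s i * Y i e.
  by rewrite /s; case: ltP => h; [rewrite ltr0_norm // mulN1r | rewrite ger0_norm // mul1r].
rewrite /Y mulr_sumr; apply: eq_bigr => u /eqP uj.
rewrite mulrCA /r big_split /=; congr (_ * (_ * _)).
rewrite (bigD1 j) //= eqxx uj big1 ?mulr1 //.
by move=> n /negPf ->.
Qed.

End Khinchine.

(** After squaring, the weights [v] have exponents [2 * th n] of total 1, as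
    [sum_le_of_fiber_bounds] requires; its hypothesis at exponent 1/2 is then the bound of
    [fiber_khinchine]. *)
Lemma weighted_square_bound (R : realType) (N d : nat) (a : d.-tuple 'I_N -> R)
    (th ga : 'I_d -> R) (M : R) :
  (0 < d)%N -> 0 <= M -> (forall n, 0 < th n) -> \sum_n th n = 2^-1 ->
  (forall (e v w : 'I_d -> 'I_N -> R), (forall n i, `|e n i| = 1) ->
     (forall n, subprob (v n)) -> (forall n, subprob (w n)) ->
     \sum_u a u * \prod_n (e n (tnth u n) *
        (v n (tnth u n) `^ th n * w n (tnth u n) `^ ga n)) <= M) ->
  forall w : 'I_d -> 'I_N -> R, (forall n, subprob (w n)) ->
    \sum_u a u ^+ 2 * \prod_n w n (tnth u n) `^ (2 * ga n) <= 3 ^+ d * M ^+ 2.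
Proof.
move=> d0 M0 th0 th1 H w sw.
have B0 : 0 <= 3 ^+ d * M ^+ 2 by rewrite mulr_ge0 ?exprn_ge0.
apply: (sum_le_of_fiber_bounds (pi := fun n u => tnth u n)
         (t := fun n => 2 * th n)) => //.
- by move=> u; rewrite mulr_ge0 ?sqr_ge0 ?prodr_ge0 // => n _; exact: powR_ge0.
- by move=> n; rewrite mulr_gt0.
- by rewrite -mulr_sumr th1 divff.
move=> v j sv.
pose c u := a u * \prod_n (v n (tnth u n) `^ th n * w n (tnth u n) `^ ga n).
have c2 u : a u ^+ 2 * \prod_n w n (tnth u n) `^ (2 * ga n) *
    \prod_n v n (tnth u n) `^ (2 * th n) = c u ^+ 2.
  rewrite /c exprMn -mulrA -big_split -prodrXl; congr (_ * _).
  apply: eq_bigr => n _; rewrite exprMn [LHS]mulrC ![2 * _]mulrC !powRrM.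
  by rewrite !powR_mulrn ?powR_ge0.
rewrite (eq_bigr (fun i => Num.sqrt (\sum_(u | tnth u j == i) c u ^+ 2))); last first.
  move=> i _; rewrite -powR12_sqrt; last by apply: sumr_ge0 => u _; exact: sqr_ge0.
  by congr (_ `^ _); apply: eq_bigr => u _; exact: c2.
have -> : (3 ^+ d * M ^+ 2) `^ 2^-1 = Num.sqrt 3 ^+ d * M.
  rewrite powR12_sqrt // -(_ : (Num.sqrt 3 ^+ d * M) ^+ 2 = 3 ^+ d * M ^+ 2).
    by rewrite sqrtr_sqr ger0_norm // mulr_ge0 ?exprn_ge0 ?sqrtr_ge0.
  by rewrite exprMn -exprM mulnC exprM sqr_sqrtr.
apply: fiber_khinchine => e e1; apply: le_trans (H e v w e1 sv sw).
rewrite le_eqVlt; apply/orP; left; apply/eqP; apply: eq_bigr => u _.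
by rewrite [in RHS]big_split /c -mulrA [in LHS](mulrC (\prod_n _)).
Qed.

(** * Scalars and multilinear forms *)

Section Scalars.
Variables (R : realType) (KK : scalar_field).
Local Notation K := (scalars R KK).

Definition scalar_of_real : R -> K :=
  match KK with RealScalars => fun x => x | ComplexScalars => fun x => x%:C%C end.

Definition real_part : K -> R :=
  match KK with RealScalars => fun x => x | ComplexScalars => @complex.Re R end.

(** Zero over the reals, so that [modulus_sqr] covers both fields. *)
Definition imaginary_part : K -> R :=
  match KK with RealScalars => fun=> 0 | ComplexScalars => @complex.Im R end.

Lemma scalar_of_realM x y :
  scalar_of_real (x * y) = scalar_of_real x * scalar_of_real y.
Proof. by rewrite /scalar_of_real; case: KK => //; exact: rmorphM. Qed.

Lemma scalar_of_real1 : scalar_of_real 1 = 1.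
Proof. by rewrite /scalar_of_real; case: KK. Qed.

Lemma real_part0 : real_part 0 = 0.
Proof. by rewrite /real_part; case: KK. Qed.

Lemma real_partD x y : real_part (x + y) = real_part x + real_part y.
Proof. by rewrite /real_part; case: KK x y => //= [] [a b] [c e]. Qed.

Lemma real_partM x y : real_part (scalar_of_real x * y) = x * real_part y.
Proof.
by rewrite /real_part /scalar_of_real; case: KK y => //= [] [a b] /=; rewrite mul0r subr0.
Qed.

Lemma imaginary_part0 : imaginary_part 0 = 0.
Proof. by rewrite /imaginary_part; case: KK. Qed.

Lemma imaginary_partD x y :
  imaginary_part (x + y) = imaginary_part x + imaginary_part y.
Proof.
by rewrite /imaginary_part; case: KK x y => [|[a b] [c e]] //=; rewrite addr0.
Qed.

Lemma imaginary_partM x y : imaginary_part (scalar_of_real x * y) = x * imaginary_part y.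
Proof.
rewrite /imaginary_part /scalar_of_real; case: KK y => [|[a b]] //=; rewrite ?mulr0 //.
by rewrite mul0r addr0.
Qed.

Lemma modulus_ge0 (x : K) : 0 <= modulus x.
Proof. by case: KK x => [x|[a b]] /=; rewrite ?sqrtr_ge0. Qed.

Lemma modulus0 : modulus (0 : K) = 0.
Proof. by case: KK; rewrite /modulus normr0. Qed.

Lemma modulusD (x y : K) : modulus (x + y) <= modulus x + modulus y.
Proof.
case: KK x y => [x y|x y]; first exact: ler_normD.
have ReD (a b : R[i]) : complex.Re (a + b) = complex.Re a + complex.Re b.
  by case: a b => [? ?] [? ?].
by have := ler_normD x y; rewrite lecE ReD => /andP[_].
Qed.

Lemma modulusM (x y : K) : modulus (x * y) = modulus x * modulus y.
Proof.
case: KK x y => [x y|x y]; first exact: normrM.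
by rewrite /modulus normrM !normc_def /= mul0r subr0.
Qed.

Lemma modulus_of_real x : modulus (scalar_of_real x) = `|x|.
Proof.
rewrite /scalar_of_real; case: KK => //=.
by rewrite expr0n addr0 sqrtr_sqr.
Qed.

Lemma modulus_sqr (x : K) : modulus x ^+ 2 = real_part x ^+ 2 + imaginary_part x ^+ 2.
Proof.
rewrite /real_part /imaginary_part; case: KK x => [x|[a b]] /=.
  by rewrite expr0n addr0 real_normK ?num_real.
by rewrite sqr_sqrtr // addr_ge0 ?sqr_ge0.
Qed.

Lemma real_part_le x : real_part x <= modulus x.
Proof.
apply: le_trans (ler_norm _) _.
by rewrite -ler_sqr ?nnegrE ?modulus_ge0 // modulus_sqr real_normK ?num_real // lerDl sqr_ge0.
Qed.

Lemma imaginary_part_le x : imaginary_part x <= modulus x.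
Proof.
apply: le_trans (ler_norm _) _.
by rewrite -ler_sqr ?nnegrE ?modulus_ge0 // modulus_sqr real_normK ?num_real // lerDr sqr_ge0.
Qed.

End Scalars.

Lemma scalar_sum (K : pzRingType) (V : lmodType K) (f : V -> K) (T : finType)
    (c : T -> K) (u : T -> V) :
  scalar f -> f (\sum_t c t *: u t) = \sum_t c t * f (u t).
Proof.
move=> fl; have f0 : f 0 = 0.
  have := fl 1 0 0; rewrite scaler0 addr0 mul1r => /esym/eqP.
  by rewrite -subr_eq0 addrK => /eqP.
have fD x y : f (x + y) = f x + f y by rewrite -[x]scale1r fl scale1r mul1r.
rewrite (big_morph f fD f0); apply: eq_bigr => t _.
by rewrite -[X in f X]addr0 fl f0 addr0.
Qed.

Section Forms.
Variables (R : realType) (KK : scalar_field) (m N : nat).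
Local Notation K := (scalars R KK).
Implicit Types (A : ('I_m -> 'rV[K]_N) -> K) (x : 'I_m -> 'rV[K]_N).

Definition basis_tuple (f : 'I_m -> 'I_N) : 'I_m -> 'rV[K]_N :=
  fun j => delta_mx ord0 (f j).

(** Arguments are expanded in the basis one at a time; [k] counts the leading ones still
    arbitrary. *)
Lemma multilinear_form_basis_eq0 A : multilinear_form A ->
  (forall f, A (basis_tuple f) = 0) -> forall x, A x = 0.
Proof.
move=> Am A0 x.
have P (k : nat) : (k <= m)%N -> forall x,
    (forall j : 'I_m, (k <= j)%N -> exists i, x j = delta_mx ord0 i) -> A x = 0.
- elim: k => [_ {}x xb|k IH km {}x xb].
    have [f fE] := choice (fun j => xb j (leq0n j)).
    by rewrite (_ : x = basis_tuple f) //; apply/funext => j; rewrite fE.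
  pose k0 := Ordinal km.
  transitivity (A [eta x with k0 |-> \sum_i x k0 ord0 i *: delta_mx ord0 i]).
    rewrite -row_sum_delta; congr A; apply/funext => j /=.
    by case: eqP => [->|].
  rewrite (scalar_sum _ _ (Am k0 x)) big1 // => i _.
  rewrite IH ?mulr0 1?ltnW // => j kj /=.
  case: eqP => [_|/eqP jk]; first by exists i.
  by apply: xb; rewrite ltn_neqAle kj andbT; move: jk; rewrite -(inj_eq val_inj) eq_sym.
by apply: (P m (leqnn m)) => j; rewrite leqNgt ltn_ord.
Qed.

(** The difference of the two sides is multilinear and vanishes on basis tuples. *)
Lemma multilinear_form_expand A : multilinear_form A -> forall x,
  A x = \sum_(f : {ffun 'I_m -> 'I_N})
    (\prod_j x j ord0 (f j)) * A (basis_tuple f).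
Proof.
move=> Am x; pose E x := \sum_(f : {ffun 'I_m -> 'I_N})
    (\prod_j x j ord0 (f j)) * A (basis_tuple f).
apply/eqP; rewrite -subr_eq0; apply/eqP; rewrite -/(E x).
apply: (@multilinear_form_basis_eq0 (fun x => A x - E x)) => [j y a u v|g].
  suff EE : E [eta y with j |-> a *: u + v]
          = a * E [eta y with j |-> u] + E [eta y with j |-> v].
    by rewrite (Am j y) EE; ring.
  rewrite /E.
  rewrite mulr_sumr -big_split; apply: eq_bigr => f _ /=.
  rewrite mulrA -mulrDl; congr (_ * _).
  have prodE w : \prod_l [eta y with j |-> w] l ord0 (f l) =
      w ord0 (f j) * \prod_(l | l != j) y l ord0 (f l).
    rewrite (bigD1 j) //= eqxx; congr (_ * _); apply: eq_bigr => l /negPf lj.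
    by rewrite lj.
  by rewrite !prodE !mxE mulrDl mulrA.
rewrite /E (bigD1 [ffun j => g j]) //= big1 => [|j _]; last first.
  by rewrite /basis_tuple ffunE mxE !eqxx.
rewrite mul1r big1 ?addr0 => [|f fg].
  apply/eqP; rewrite subr_eq0; apply/eqP; congr A.
  by apply/funext => j; rewrite /basis_tuple ffunE.
have /existsP[j fgj] : [exists j, f j != g j].
  rewrite -negb_forall; apply: contra fg => /forallP fg.
  by apply/eqP/ffunP => j; rewrite ffunE (eqP (fg j)).
rewrite (bigD1 j) //= /basis_tuple mxE eqxx /= (negPf fgj) mul0r mul0r //.
Qed.

Definition real_tuple (y : 'I_m -> 'I_N -> R) : 'I_m -> 'rV[K]_N :=
  fun j => \row_i scalar_of_real KK (y j i).

(** Meant for [psi] the real or imaginary part, which commutes with real factors and so passes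
    through the expansion. *)
Lemma multilinear_form_real A (y : 'I_m -> 'I_N -> R) (psi : K -> R) :
  multilinear_form A -> psi 0 = 0 -> (forall a b, psi (a + b) = psi a + psi b) ->
  (forall a b, psi (scalar_of_real KK a * b) = a * psi b) ->
  psi (A (real_tuple y)) = \sum_(f : {ffun 'I_m -> 'I_N})
    psi (A (basis_tuple f)) * \prod_j y j (f j).
Proof.
move=> Am psi0 psiD psiM; rewrite (multilinear_form_expand Am).
rewrite (big_morph psi psiD psi0); apply: eq_bigr => f _.
rewrite [RHS]mulrC -psiM; congr (psi (_ * _)).
rewrite (big_morph _ (@scalar_of_realM R KK) (@scalar_of_real1 R KK)).
by apply: eq_bigr => j _; rewrite mxE.
Qed.

Lemma lp_norm_real_tuple (q : R) (y : 'I_m -> 'I_N -> R) j :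
  0 <= q -> \sum_i `|y j i| `^ q <= 1 -> lp_norm q (real_tuple y j) <= 1.
Proof.
move=> q0 yq; rewrite /lp_norm.
have -> : \sum_(i < N) modulus (real_tuple y j ord0 i) `^ q = \sum_i `|y j i| `^ q.
  by apply: eq_bigr => i _; rewrite mxE modulus_of_real.
apply: powR_le1; rewrite ?invr_ge0 // yq andbT.
by apply: sumr_ge0 => i _; exact: powR_ge0.
Qed.

Lemma modulus_le_lp_norm (q : R) (v : 'rV[K]_N) i :
  0 < q -> modulus (v ord0 i) <= lp_norm q v.
Proof.
move=> q0; rewrite -[leLHS](powRr1 (modulus_ge0 _)) -(@divff _ q) ?gt_eqF // powRrM.
apply: ge0_ler_powR; rewrite ?nnegrE ?invr_ge0 ?powR_ge0 ?(ltW q0) //.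
  by apply: sumr_ge0 => l _; exact: powR_ge0.
by rewrite (bigD1 i) //= lerDl; apply: sumr_ge0 => l _; exact: powR_ge0.
Qed.

Lemma form_norm_ge A (p : 'I_m -> R) x : multilinear_form A ->
  (forall j, 0 < p j) -> (forall j, lp_norm (p j) (x j) <= 1) ->
  modulus (A x) <= form_norm p A.
Proof.
move=> Am p0 x1; apply: ub_le_sup; last by exists x.
(* An upper bound for the set of the supremum: vectors in the unit balls have coordinates of modulus
   at most 1. *)
exists (\sum_(f : {ffun 'I_m -> 'I_N}) modulus (A (basis_tuple f))) => _ [z z1 <-].
rewrite (multilinear_form_expand Am).
elim/big_ind2: _ => [|a b c e ab ce|f _].
- by rewrite modulus0.
- exact: le_trans (modulusD _ _) (lerD ab ce).
rewrite modulusM ler_piMl ?modulus_ge0 //.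
elim/big_ind: _ => [|a b a1 b1|j _].
- by rewrite -(scalar_of_real1 R KK) modulus_of_real normr1.
- by rewrite modulusM mulr_ile1 ?modulus_ge0.
exact: le_trans (modulus_le_lp_norm _ _ (p0 j)) (z1 j).
Qed.

Lemma form_norm_ge0 A (p : 'I_m -> R) : multilinear_form A ->
  (forall j, 0 < p j) -> 0 <= form_norm p A.
Proof.
move=> Am p0; apply: le_trans (modulus_ge0 (A (real_tuple (fun _ _ => 0)))) _.
apply: form_norm_ge => // j; apply: lp_norm_real_tuple; first exact: ltW.
by rewrite big1 ?ler01 // => i _; rewrite normr0 powR0 // gt_eqF.
Qed.


End Forms.

Arguments basis_tuple {R KK m N} f.

(** * Restriction to block diagonals *)

Section Diagonal.
Variable R : realType.
Local Notation sg := (rademacher R).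

Lemma rademacher_orthogonal (N : nat) (a b : 'I_N) :
  \sum_(e : {ffun 'I_N -> bool}) sg (e a) * sg (e b)
    = if a == b then 2 ^+ N else 0.
Proof.
have sqs c : sg c * sg c = 1.
  by rewrite /rademacher -signr_addb addbb.
case: eqP => [->|/eqP ab].
  rewrite (eq_bigr (fun=> 1)) // sumr_const card_ffun card_bool card_ord.
  by rewrite natrX.
(* Flipping the sign at [a] is an involution that negates every summand. *)
pose h (e : {ffun 'I_N -> bool}) := [ffun i => e i (+) (i == a)].
have hK : involutive h.
  by move=> e; apply/ffunP => i; rewrite !ffunE -addbA addbb addbF.
set S := \sum_e _.
suff : S = - S by move=> /eqP; rewrite -addr_eq0 -mulr2n mulrn_eq0 => /eqP.
rewrite {1}/S (reindex_inj (inv_inj hK)) -sumrN; apply: eq_bigr => e _.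
rewrite !ffunE eqxx [b == a]eq_sym (negPf ab) addbF addbT.
by rewrite /rademacher signrN mulNr.
Qed.

(* Averaging over the signs [e], where the [j]-th argument is multiplied by
   [e j] and by the [e k] for [rep (be k) = j], keeps exactly the terms whose
   index is constant along the fibers of [be]. *)
Lemma diagonal_bound (m d N : nat) (al : {ffun 'I_m -> 'I_N} -> R)
    (be : 'I_m -> 'I_d) (rep : 'I_d -> 'I_m) (y : 'I_m -> 'I_N -> R) (M : R) :
  cancel rep be ->
  (forall e : 'I_m -> 'I_N -> R, (forall j i, `|e j i| = 1) ->
     \sum_f al f * \prod_j (e j (f j) * y j (f j)) <= M) ->
  \sum_(u : d.-tuple 'I_N) al [ffun j => tnth u (be j)]
     * \prod_j y j (tnth u (be j)) <= M.
Proof.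
move=> repK H; pose l j := rep (be j).
pose E := {ffun 'I_m -> {ffun 'I_N -> bool}}.
pose s (e : E) j i : R := sg (e j i) * \prod_(k | l k == j) sg (e k i).
have sg1 b : `|sg b| = 1 by rewrite /rademacher normrX normrN normr1 expr1n.
have s1 e j i : `|s e j i| = 1.
  rewrite normrM sg1 mul1r normr_prod big1 // => k _; exact: sg1.
have pp : 0 < (2 ^+ N) ^+ m :> R by rewrite !exprn_gt0.
rewrite -(ler_pM2l pp).
have -> : (2 ^+ N) ^+ m * M = \sum_(e : E) M.
  by rewrite sumr_const !card_ffun card_bool !card_ord -[RHS]mulr_natl !natrX.
apply: le_trans (ler_sum _ (fun e _ => H (s e) (s1 e))).
rewrite exchange_big /=.
(* Regrouped along [l], the signs [e j] occur at [f j] and at [f (l j)]; the sum factors over [j],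
   and orthogonality forces [f j = f (l j)]. *)
have sE (f : {ffun 'I_m -> 'I_N}) : \sum_(e : E) \prod_j s e j (f j)
    = if [forall j, f j == f (l j)] then (2 ^+ N) ^+ m else 0.
  have -> : \sum_(e : E) \prod_j s e j (f j)
      = \sum_(e : E) \prod_j (sg (e j (f j)) * sg (e j (f (l j)))).
    apply: eq_bigr => e _; rewrite !big_split /=; congr (_ * _).
    rewrite [RHS](partition_big l predT) //=; apply: eq_bigr => j _.
    by apply: eq_bigr => k /eqP ->.
  rewrite -(bigA_distr_bigA (fun j (g : {ffun 'I_N -> bool}) =>
    sg (g (f j)) * sg (g (f (l j))))) /=.
  case: ifPn => [/forallP fl|].
    rewrite (eq_bigr (fun=> 2 ^+ N)) ?prodr_const ?card_ord // => j _.
    by rewrite rademacher_orthogonal fl.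
  rewrite negb_forall => /existsP[j /negPf fj].
  by rewrite (bigD1 j) //= rademacher_orthogonal fj mul0r.
have -> : \sum_(f : {ffun 'I_m -> 'I_N}) \sum_(e : E) al f * \prod_j (s e j (f j) * y j (f j))
  = (2 ^+ N) ^+ m * \sum_(f : {ffun 'I_m -> 'I_N} | [forall j, f j == f (l j)]) al f * \prod_j y j (f j).
  rewrite [in RHS]big_mkcond mulr_sumr; apply: eq_bigr => f _.
  transitivity (\sum_(e : E) (\prod_j s e j (f j)) * (al f * \prod_j y j (f j))).
    by apply: eq_bigr => e _; rewrite big_split mulrCA.
  by rewrite -mulr_suml sE; case: ifP => _; rewrite ?mul0r ?mulr0.
rewrite ler_pM2l //.
rewrite [leRHS](reindex_onto (fun u : d.-tuple 'I_N => [ffun j => tnth u (be j)])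
  (fun f => [tuple f (rep n) | n < d])) /=; last first.
  move=> f /forallP fl; apply/ffunP => j.
  by rewrite ffunE tnth_mktuple -(eqP (fl j)).
rewrite le_eqVlt; apply/orP; left; apply/eqP.
apply: eq_big => [u|u _].
  apply/esym/andP; split.
    by apply/forallP => j; rewrite !ffunE /l repK.
  apply/eqP/eq_from_tnth => n; by rewrite tnth_mktuple ffunE repK.
by congr (_ * _); apply: eq_bigr => j _; rewrite ffunE.
Qed.

Lemma powR_sum (T : finType) (P : pred T) (x : R) (F : T -> R) :
  0 <= x -> (forall t, 0 <= F t) ->
  \prod_(t | P t) x `^ F t = x `^ (\sum_(t | P t) F t).
Proof.
move=> x0 F0; have [->|xn0] := eqVneq x 0; last first.
  elim/big_rec2: _ => [|t a b _ ->]; first by rewrite powRr0.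
  by rewrite powRD // xn0 implybT.
have [S0|Sn0] := eqVneq (\sum_(t | P t) F t) 0.
  rewrite S0 powRr0 big1 // => t Pt.
  by rewrite (psumr_eq0P _ S0) ?powRr0.
rewrite powR0 //; have /existsP[t /andP[Pt Ft]] : [exists t, P t && (F t != 0)].
  apply: contraNT Sn0; rewrite negb_exists => /forallP F1.
  rewrite big1 // => t Pt; apply/eqP; move: (F1 t); rewrite Pt /=.
  by rewrite negbK.
by rewrite (bigD1 t) //= powR0 // mul0r.
Qed.

(** Since [p j <= 2 * m%:R], the exponent [(p j)^-1] splits into [(2 * m%:R)^-1] for [v] and a
    nonnegative rest for [w]; Hölder's inequality puts the resulting products in the unit ball of
    l_(p j). *)
Lemma block_weights_bound (m d N : nat) (al : {ffun 'I_m -> 'I_N} -> R)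
    (be : 'I_m -> 'I_d) (rep : 'I_d -> 'I_m) (p : 'I_m -> R) (M : R) :
  cancel rep be -> (forall j, 0 < p j <= 2 * m%:R) ->
  (forall y : 'I_m -> 'I_N -> R, (forall j, \sum_i `|y j i| `^ p j <= 1) ->
     \sum_f al f * \prod_j y j (f j) <= M) ->
  forall e v w : 'I_d -> 'I_N -> R, (forall n i, `|e n i| = 1) ->
    (forall n, subprob (v n)) -> (forall n, subprob (w n)) ->
  \sum_(u : d.-tuple 'I_N) al [ffun j => tnth u (be j)] *
    \prod_n (e n (tnth u n) *
      (v n (tnth u n) `^ (\sum_(j | be j == n) (2 * m%:R)^-1) *
       w n (tnth u n) `^ (\sum_(j | be j == n) ((p j)^-1 - (2 * m%:R)^-1)))) <= M.
Proof.
move=> repK pb H e v w e1 sv sw.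
pose q : R := (2 * m%:R)^-1.
have pp j : 0 < p j by case/andP: (pb j).
have mp (j : 'I_m) : (0 : R) < 2 * m%:R.
  by case/andP: (pb j) => p0 p1; exact: lt_le_trans p0 p1.
have q0 : 0 <= q by rewrite invr_ge0 mulr_ge0.
have qp j : 0 <= (p j)^-1 - q.
  by rewrite subr_ge0 /q lef_pV2 ?posrE ?mp //; case/andP: (pb j).
(* The representative alone carries the sign of its block, so the sign occurs once in the product
   over the block. *)
pose y j i := (if rep (be j) == j then e (be j) i else 1) *
  (v (be j) i `^ q * w (be j) i `^ ((p j)^-1 - q)).
have yE (u : d.-tuple 'I_N) : \prod_j y j (tnth u (be j)) = \prod_n (e n (tnth u n) *
      (v n (tnth u n) `^ (\sum_(j | be j == n) q) *
       w n (tnth u n) `^ (\sum_(j | be j == n) ((p j)^-1 - q)))).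
  rewrite (partition_big be predT) //=; apply: eq_bigr => n _.
  rewrite [LHS]big_split [X in _ * X = _]big_split /=; congr (_ * (_ * _)).
  - rewrite (bigD1 (rep n)) /= ?repK ?eqxx // big1 ?mulr1 // => j /andP[/eqP <-].
    by rewrite eq_sym => /negPf ->.
  - rewrite -(@powR_sum _ (fun j => be j == n) _ (fun=> q)) //; last by case: (sv n).
    by apply: eq_bigr => j /eqP ->.
  rewrite -(@powR_sum _ (fun j => be j == n) _ (fun j => (p j)^-1 - q)) //;
    last by case: (sw n).
  by apply: eq_bigr => j /eqP ->.
under eq_bigr => u _ do rewrite -yE.
apply: (diagonal_bound repK) => s s1; apply: (H (fun j i => s j i * y j i)) => j.
have pq : 0 <= q * p j <= 1.
  rewrite mulr_ge0 ?(ltW (pp j)) //= /q mulrC ler_pdivrMr ?mp // mul1r.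
  by case/andP: (pb j).
have [v0 v1] := sv (be j); have [w0 w1] := sw (be j).
apply: (@le_trans _ _ (\sum_i v (be j) i `^ (q * p j) * w (be j) i `^ (1 - q * p j))).
  rewrite le_eqVlt; apply/orP; left; apply/eqP; apply: eq_bigr => i _.
  rewrite normrM s1 mul1r normrM.
  have -> : `|if rep (be j) == j then e (be j) i else 1| = 1.
    by case: ifP; rewrite ?normr1.
  rewrite mul1r ger0_norm ?mulr_ge0 ?powR_ge0 // powRM ?powR_ge0 //.
  by rewrite -!powRrM mulrBl mulVf ?gt_eqF.
apply: le_trans (hoelder_sum predT v0 w0 pq) _.
case/andP: pq => pq0 pq1.
by apply: mulr_ile1; rewrite ?powR_ge0 ?powR_le1 ?sumr_ge0 ?subr_ge0.
Qed.

End Diagonal.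

(** * Block exponents *)

Lemma partition_block_index (m d : nat) (I : 'I_d -> {set 'I_m}) :
  injective I ->
  finset.partition [set I n | n : 'I_d]%SET [set: 'I_m]%SET ->
  exists be : 'I_m -> 'I_d, exists rep : 'I_d -> 'I_m,
    cancel rep be /\ forall j n, (j \in I n) = (be j == n).
Proof.
move=> Iinj /and3P[/eqP Icov Itriv I0].
have bP j : exists n, j \in I n.
  have /bigcupP[B /imsetP[n _ ->] jn] : j \in finset.cover [set I n | n : 'I_d]%SET.
    by rewrite Icov inE.
  by exists n.
have [be beP] := choice bP; exists be.
have beE j n : (j \in I n) = (be j == n).
  apply/idP/eqP => [jn|<- //].
  have [In|] := eqVneq (I (be j)) (I n); first exact: Iinj.
  move/(finset.trivIsetP Itriv _ _ (imset_f I isT) (imset_f I isT)).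
  by move/disjointFr => /(_ _ (beP j)); rewrite jn.
have rP n : exists j, j \in I n.
  apply/finset.set0Pn/eqP => In0; move: I0; rewrite -In0.
  by rewrite imset_f.
have [rep repP] := choice rP; exists rep; split=> // n.
by apply/eqP; rewrite -beE.
Qed.

Section BlockExponents.
Variables (R : realType) (m d : nat) (I : 'I_d -> {set 'I_m}) (p : 'I_m -> R).
Variable be : 'I_m -> 'I_d.
Hypothesis beE : forall j n, (j \in I n) = (be j == n).

(** What block [n] subtracts from 1/2 in the reciprocal block exponents; the index is in [nat] so
    that tails are sums over intervals. *)
Definition excess (n : nat) : R :=
  \sum_(j | be j == n :> nat) ((p j)^-1 - (2 * m%:R)^-1).

Lemma sum_excess (k : nat) : \sum_(k <= n < d) excess n
  = \sum_(j | (k <= be j)%N) ((p j)^-1 - (2 * m%:R)^-1).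
Proof.
rewrite big_geq_mkord /excess [RHS](partition_big be (fun n : 'I_d => (k <= n)%N)) //=.
apply: eq_bigr => n kn; apply: eq_bigl => j; rewrite (inj_eq val_inj).
by case: eqP => [->|]; rewrite ?kn ?andbF.
Qed.

(** The cardinality term, spread over the elements of the tail blocks, corrects each [(p j)^-1] by
    [(2 * m%:R)^-1]. *)
Lemma block_exponentV (k : 'I_d) :
  (block_exponent I p k)^-1 = 2^-1 - \sum_(k <= n < d) excess n.
Proof.
rewrite sum_excess /block_exponent invrK sumrB opprB addrA addrAC.
congr (_ - _ + _).
  apply: eq_bigl => j; apply/bigcupP/idP => [[n kn]|kj].
    by rewrite beE => /eqP ->.
  by exists (be j) => //; rewrite beE.
rewrite sumr_const -[RHS]mulr_natr; congr (_ * _%:R).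
rewrite -sum1_card (partition_big be (fun n : 'I_d => (k <= n)%N)) //=.
apply: eq_bigr => n kn; rewrite -sum1_card; apply: eq_bigl => j.
rewrite beE; case: eqP => [jn|_]; last by rewrite andbF.
by rewrite andbT unfold_in jn.
Qed.

End BlockExponents.

(** * Assembly of the mixed-norm bound *)

Theorem theorem4p3 (R : realType) (KK : scalar_field) (m d : nat)
    (I : 'I_d -> {set 'I_m}) (p : 'I_m -> R)
    (m_gt0 : (0 < m)%N)
    (I_inj : injective I)
    (I_partition : finset.partition [set I n | n : 'I_d]%SET [set: 'I_m]%SET)
    (p_bounds : forall j, 1 < p j <= 2 * m%:R)
    (p_sum : \sum_(j < m) (p j)^-1 < 1) :
  let s : d.-tuple R := [tuple block_exponent I p k | k < d] in
  exists D : R, 1 <= D /\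
    forall (N : nat) (A : ('I_m -> 'rV[scalars R KK]_N) -> scalars R KK),
      (0 < N)%N -> multilinear_form A ->
      mixed_sum s (fun i : d.-tuple 'I_N => modulus (A (block_basis I i)))
        <= D * form_norm p A.
Proof.
move=> s; have [be [rep [repK beE]]] := partition_block_index I_inj I_partition.
have pb j : 0 < p j <= 2 * m%:R.
  by have /andP[p1 ->] := p_bounds j; rewrite (lt_trans ltr01).
have p0 j : 0 < p j by have /andP[] := pb j.
have mp : 0 < 2 * m%:R :> R by rewrite mulr_gt0 // ltr0n.
have pq0 j : 0 <= (p j)^-1 - (2 * m%:R)^-1.
  by rewrite subr_ge0 lef_pV2 ?posrE //; case/andP: (pb j).
pose e n := 2 * excess p be n.
have ex0 n : 0 <= excess p be n by apply: sumr_ge0 => j _.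
have e0 n : 0 <= e n by rewrite mulr_ge0.
have d0 : (0 < d)%N by case: (be (Ordinal m_gt0)) => [k]; case: (d).
have mq : \sum_(j < m) (2 * m%:R)^-1 = 2^-1 :> R.
  by rewrite sumr_const card_ord -[LHS]mulr_natr invfM divfK // pnatr_eq0 -lt0n.
(* By [p_sum] all excesses together stay below 1/2, which makes every block exponent positive. *)
have Se k : \sum_(k <= n < d) e n < 1.
  rewrite -mulr_sumr sum_excess.
  have : \sum_(j | (k <= be j)%N) ((p j)^-1 - (2 * m%:R)^-1)
      <= \sum_(j < m) ((p j)^-1 - (2 * m%:R)^-1).
    rewrite [leRHS](bigID (fun j => (k <= be j)%N)) /= lerDl.
    by apply: sumr_ge0 => j _.
  by rewrite [X in _ <= X -> _]sumrB mq; lra.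
(* Halved exponents suit the squared moduli; at index [d] the default 1 matches the empty tail
   sum. *)
pose t := [tuple of map ( *%R 2^-1) s].
have tE k : (k <= d)%N -> (nth 1 t k)^-1 = 1 - \sum_(k <= n < d) e n.
  rewrite leq_eqVlt => /predU1P[->|kd].
    by rewrite big_geq // nth_default ?size_tuple // invr1 subr0.
  rewrite (nth_map 1) ?size_tuple // (_ : k = Ordinal kd) // nth_mktuple.
  rewrite invfM invrK (block_exponentV _ beE) mulrBr mulfV // -mulr_sumr.
  by [].
have t0 k : (k <= d)%N -> 0 < nth 1 t k.
  by move=> kd; rewrite -invr_gt0 tE // subr_gt0.
(* The 2 adds the bounds for real and imaginary parts, [3 ^+ d] comes from Khinchine's inequality in
   [d] coordinates, and the root undoes the squaring. *)
exists (Num.sqrt (2 * 3 ^+ d)); split.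
  have d1 : (1 : R) <= 3 ^+ d by rewrite exprn_ege1 // ler1n.
  by rewrite -[leLHS]sqrtr1 ler_wsqrtr //; lra.
move=> N A N0 Am; set M := form_norm p A.
have M0 : 0 <= M by exact: form_norm_ge0.
pose a (u : d.-tuple 'I_N) := A (block_basis I u).
have aE u : a u = A (basis_tuple [ffun j => tnth u (be j)]).
  congr A; apply/funext => j; rewrite /block_basis /basis_tuple ffunE.
  rewrite (eq_bigl (pred1 (be j))) ?big_pred1_eq // => n.
  by rewrite beE eq_sym.
have part_bound psi : psi 0 = 0 -> (forall a b, psi (a + b) = psi a + psi b) ->
    (forall a b, psi (scalar_of_real KK a * b) = a * psi b) ->
    (forall a, psi a <= modulus a) ->
    forall w : nat -> 'I_N -> R, (forall n, subprob (w n)) ->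
    \sum_u psi (a u) ^+ 2 * \prod_(n < d) w n (tnth u n) `^ e n <= 3 ^+ d * M ^+ 2.
- move=> psi0 psiD psiM psiN w sw.
  pose th (n : 'I_d) : R := \sum_(j | be j == n) (2 * m%:R)^-1.
  pose ga (n : 'I_d) : R := \sum_(j | be j == n) ((p j)^-1 - (2 * m%:R)^-1).
  apply: (@weighted_square_bound _ _ _ _ th ga M _ _ _ _ _ (fun n : 'I_d => w n)) => //.
  + move=> n; rewrite /th (bigD1 (rep n)) /= ?repK //.
    by rewrite ltr_pwDl ?invr_gt0 // sumr_ge0 // => j _; rewrite invr_ge0 ltW.
  + by rewrite -mq [RHS](partition_big be predT).
  move=> sgn v w' sgn1 sv sw'.
  under eq_bigr => u _ do rewrite aE.
  apply: (block_weights_bound (al := fun f => psi (A (basis_tuple f))) repK pb) => //.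
  move=> y yp; have <- := multilinear_form_real y Am psi0 psiD psiM.
  apply: le_trans (psiN _) _; apply: form_norm_ge => // j.
  by apply: lp_norm_real_tuple; rewrite ?yp // ltW.
have L0 : 0 <= 2 * (3 ^+ d * M ^+ 2) by rewrite !mulr_ge0 ?exprn_ge0.
have H : nested_sum t (fun u => modulus (a u) ^+ 2)
    <= (2 * (3 ^+ d * M ^+ 2)) `^ nth 1 t 0.
  apply: (nested_sum_dual e0 t0 tE) => [u|w sw]; first exact: sqr_ge0.
  under eq_bigr => u _ do rewrite modulus_sqr mulrDl.
  rewrite big_split /= mulr_natl mulr2n; apply: lerD; apply: part_bound => //.
  - exact: real_part0.
  - exact: real_partD.
  - exact: real_partM.
  - exact: real_part_le.
  - exact: imaginary_part0.
  - exact: imaginary_partD.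
  - exact: imaginary_partM.
  - exact: imaginary_part_le.
have sE : s = [tuple of map ( *%R 2) t].
  have ts k : tnth t k = 2^-1 * tnth s k by exact: tnth_map.
  by apply: eq_from_tnth => k; rewrite [RHS]tnth_map ts mulVKf.
rewrite /mixed_sum.
have -> : head 1 s = 2 * nth 1 t 0.
  by rewrite -nth0 sE (nth_map 1) // size_tuple.
have -> : nested_sum s (fun u => modulus (a u)) = nested_sum t (fun u => modulus (a u) ^+ 2).
  by rewrite sE; apply: nested_sum_double => // u; exact: modulus_ge0.
apply: (@le_trans _ _ (((2 * (3 ^+ d * M ^+ 2)) `^ nth 1 t 0) `^ (2 * nth 1 t 0)^-1)).
  apply: ge0_ler_powR; rewrite ?nnegrE ?powR_ge0 //.
    by rewrite invr_ge0 mulr_ge0 // ltW // t0.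
  by apply: nested_sum_ge0 => u; exact: sqr_ge0.
rewrite -powRrM.
have -> : nth 1 t 0 / (2 * nth 1 t 0) = 2^-1.
  by rewrite invfM mulrCA divff ?mulr1 // gt_eqF // t0.
rewrite powR12_sqrt //.
have c0 : 0 <= 2 * 3 ^+ d :> R by rewrite mulr_ge0 ?exprn_ge0.
by rewrite mulrA [leLHS](sqrtrM _ c0) sqrtr_sqr ger0_norm.
Qed.
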